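(* Let $\mathbb F$ be a field, $n=4$, and let $\mathfrak q=(q_{ij})$ be a multiplicatively antisymmetric $4\times4$ matrix over $\mathbb F^\ast$ with associated quantum torus $\mathcal O_{\mathfrak q}((\mathbb F^\ast)^4)$. Suppose that the group $\Lambda=\langle q_{ij}\rangle\le\mathbb F^\ast$ is freely generated (as an abelian group) by the commutators $[X_1,X_4]=q_{14}$, $[X_2,X_3]=q_{23}$, $[X_2,X_4]=q_{24}$ and $[X_3,X_4]=q_{34}$, while $[X_1,X_2]=[X_1,X_3]=1$ (i.e. $q_{12}=q_{13}=1$). Then $$\mathrm{Aut}(\mathbb Z^4,\lambda)=\left\{\begin{pmatrix}\epsilon&0&0&-b\\0&\epsilon&0&0\\0&0&\epsilon&0\\0&0&0&\epsilon\end{pmatrix}\ :\ b\in\mathbb Z,\ \epsilon\in\{\pm1\}\right\}.$$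
   Context: Multiplicatively antisymmetric means $q_{ii}=1$ and $q_{ji}=q_{ij}^{-1}$. The quantum torus is the $\mathbb F$-algebra generated by $X_1^{\pm1},\dots,X_n^{\pm1}$ subject to $X_iX_j=q_{ij}X_jX_i$; $[u,v]=uvu^{-1}v^{-1}$ for units $u,v$. For $\mathbf m\in\mathbb Z^n$ put $\mathbf X^{\mathbf m}=X_1^{m_1}\cdots X_n^{m_n}$ and $\lambda(\mathbf m,\mathbf m')=[\mathbf X^{\mathbf m},\mathbf X^{\mathbf m'}]\in\mathbb F^\ast$, an alternating $\mathbb Z$-bilinear map with $\lambda(\mathbf e_i,\mathbf e_j)=q_{ij}$. $\mathrm{Aut}(\mathbb Z^n,\lambda)$ is the group of all $\sigma\in\mathrm{GL}(n,\mathbb Z)$ (acting on column vectors) with $\lambda(\sigma\mathbf m,\sigma\mathbf m')=\lambda(\mathbf m,\mathbf m')$ for all $\mathbf m,\mathbf m'\in\mathbb Z^n$. *)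

(* Defs.v *)
From HB Require Import structures.
From mathcomp Require Import all_boot all_order all_algebra.

Set Implicit Arguments.
Unset Strict Implicit.
Unset Printing Implicit Defensive.

Import Order.TTheory GRing.Theory Num.Theory.
Local Open Scope ring_scope.

(* Indices are 0-based throughout: entry (i, j) is the informal q_{i+1,j+1}. *)

Definition mult_antisymmetric (F : fieldType) (n : nat) (q : 'M[F]_n) : Prop :=
  [/\ forall i j, q i j != 0,
      forall i, q i i = 1
    & forall i j, q j i = (q i j)^-1].

(* (A, X) is the F-algebra presented by generators X_i^{+-1} and relations
   X_i X_j = q_ij X_j X_i.  The presentation is expressed by its universal
   property, which determines (A, X) up to a unique isomorphism; Z_i is the
   image of X_i^-1. *)
Definition is_quantum_torus (F : fieldType) (n : nat) (q : 'M[F]_n)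
    (A : unitAlgType F) (X : 'I_n -> A) : Prop :=
  [/\ forall i, X i \is a GRing.unit,
      forall i j, X i * X j = q i j *: (X j * X i)
    & forall (B : algType F) (Y Z : 'I_n -> B),
        (forall i, Y i * Z i = 1) ->
        (forall i, Z i * Y i = 1) ->
        (forall i j, Y i * Y j = q i j *: (Y j * Y i)) ->
        exists2 phi : {lrmorphism A -> B},
          forall i, phi (X i) = Y i
        & forall psi : {lrmorphism A -> B},
            (forall i, psi (X i) = Y i) -> psi =1 phi].

Definition commutator (A : unitRingType) (u v : A) : A :=
  u * v * u^-1 * v^-1.

(* The product is not commutative: \prod multiplies in increasing order of
   the index. *)
Definition monomial (A : unitRingType) (n : nat) (X : 'I_n -> A)
    (m : 'cV[int]_n) : A :=
  \prod_(i < n) X i ^ m i 0.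

(* Scalars are not pulled back to F: the values c of the informal lambda
   appear here as c%:A, with c |-> c%:A injective. *)
Definition lambda (A : unitRingType) (n : nat) (X : 'I_n -> A)
    (m m' : 'cV[int]_n) : A :=
  commutator (monomial X m) (monomial X m').

Definition in_Aut (A : unitRingType) (n : nat) (X : 'I_n -> A)
    (s : 'M[int]_n) : Prop :=
  s \in unitmx /\
  forall m m' : 'cV[int]_n, lambda X (s *m m) (s *m m') = lambda X m m'.

(* Membership in the subgroup of F^* generated by the nonzero elements g i. *)
Definition in_gen (F : fieldType) (I : finType) (g : I -> F) (x : F) : Prop :=
  exists k : {ffun I -> int}, x = \prod_i g i ^ k i.

Definition in_Lambda (F : fieldType) (n : nat) (q : 'M[F]_n) (x : F) : Prop :=
  in_gen (fun p : 'I_n * 'I_n => q p.1 p.2) x.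

Definition freely_generated_by (F : fieldType) (L : F -> Prop)
    (I : finType) (g : I -> F) : Prop :=
  (forall x, L x <-> in_gen g x) /\
  injective (fun k : {ffun I -> int} => \prod_i g i ^ k i).

Definition mx_of_rows (R : nzRingType) (m n : nat) (r : seq (seq R)) :
    'M[R]_(m, n) :=
  \matrix_(i < m, j < n) nth 0 (nth [::] r i) j.

(* Main.v *)
Require Import Defs.
From HB Require Import structures.
From mathcomp Require Import all_boot all_order all_algebra.
From mathcomp Require Import ring.

Set Implicit Arguments.
Unset Strict Implicit.
Unset Printing Implicit Defensive.

Import Order.TTheory GRing.Theory Num.Theory.
Local Open Scope ring_scope.

(** Indices start at 1 in this comment, at 0 in the code.

    The commutation relations of the quantum torus give
    [X^m, X^m'] = \prod_(i, j) q_ij ^ (m_i m'_j) for monomials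
    ([skew_commute_monomial]).  Antisymmetry of q and q_12 = q_13 = 1 collapse
    this product to q_14, q_23, q_24 and q_34 raised to the Pluecker
    coordinates (1,4), (2,3), (2,4), (3,4) of the pair (m, m') ([lambdaE]).
    As these four scalars are free generators, and as scalars embed in a
    nonzero algebra, s preserves lambda exactly when it preserves each of the
    four alternating forms e_i^* /\ e_j^* separately ([in_AutE]).

    In terms of the rows r_i of s, preserving e_i^* /\ e_j^* means
    r_i /\ r_j = e_i^* /\ e_j^*, so r_i and r_j both lie in the span of e_i^*
    and e_j^* ([preserves_plucker_row]).  Since r_2 lies in
    <e_2^*, e_3^*> and in <e_2^*, e_4^*>, it is a multiple of e_2^*; in the same
    way r_3 and r_4 are multiples of e_3^* and e_4^*, and r_1 lies in
    <e_1^*, e_4^*>.  The diagonal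
    entries have pairwise products 1 along the four pairs, so over the integers
    they are all equal to one sign ([signed_shear_of_preserves_plucker]).  The
    entry of r_1 along e_4^* is unconstrained, because r_4 is proportional to
    e_4^*.  Conversely such a matrix visibly preserves the four forms. *)

(** * Commutators of monomials *)

Definition skew_commute (F : fieldType) (A : algType F) (c : F) (u v : A) :=
  u * v = c *: (v * u).

Lemma skew_commuteV (F : fieldType) (A : algType F) (c : F) (u v : A) :
  c != 0 -> skew_commute c u v -> skew_commute c^-1 v u.
Proof.
by move=> c0; rewrite /skew_commute => ->; rewrite scalerA mulVf ?scale1r.
Qed.

(** Skew-commutation with a fixed [v] is a condition closed under products,
    in which the constants multiply; everything about monomials follows from
    this, inverses, and the symmetry [skew_commuteV] between [u] and [v]. *)
Lemma skew_commuteM (F : fieldType) (A : algType F) (c d : F) (u w v : A) :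
  skew_commute c u v -> skew_commute d w v -> skew_commute (c * d) (u * w) v.
Proof.
rewrite /skew_commute => uv wv.
by rewrite -mulrA wv -scalerAr (mulrA u) uv -scalerAl scalerA -mulrA (mulrC d).
Qed.

Lemma skew_commute_inv (F : fieldType) (A : unitAlgType F) (c : F) (u v : A) :
    c != 0 -> u \is a GRing.unit ->
  skew_commute c u v -> skew_commute c^-1 u^-1 v.
Proof.
move=> c0 uU uv; apply: (mulrI uU).
rewrite mulVKr // -scalerAr (mulrA u) uv -scalerAl scalerA mulVf //.
by rewrite scale1r mulrK.
Qed.

Lemma skew_commuteXz (F : fieldType) (A : unitAlgType F) (c : F) (u v : A)
    (k : int) :
    c != 0 -> u \is a GRing.unit ->
  skew_commute c u v -> skew_commute (c ^ k) (u ^ k) v.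
Proof.
move=> c0 uU uv.
have natX n : skew_commute (c ^+ n) (u ^+ n) v.
  elim: n => [|n IHn].
    by rewrite /skew_commute !expr0 scale1r mul1r mulr1.
  by rewrite !exprS; apply: skew_commuteM.
case: k => n; first exact: natX.
by apply: skew_commute_inv; rewrite ?expf_neq0 ?unitrX.
Qed.

Lemma skew_commute_prod (F : fieldType) (A : algType F) (n : nat)
    (c : 'I_n -> F) (u : 'I_n -> A) (v : A) :
    (forall i, skew_commute (c i) (u i) v) ->
  skew_commute (\prod_(i < n) c i) (\prod_(i < n) u i) v.
Proof.
move=> uv.
apply: (big_ind2 (fun d w => skew_commute d w v)) => // [|d w e x dw ex].
- by rewrite /skew_commute scale1r mul1r mulr1.
- exact: skew_commuteM.
Qed.

(** The bicharacter formula: the constant is multiplicative in each argument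
    separately, so it expands over the factors of both monomials. *)
Lemma skew_commute_monomial (F : fieldType) (n : nat) (q : 'M[F]_n)
    (A : unitAlgType F) (X : 'I_n -> A) (m m' : 'cV[int]_n) :
    (forall i j, q i j != 0) ->
    (forall i, X i \is a GRing.unit) ->
    (forall i j, skew_commute (q i j) (X i) (X j)) ->
  skew_commute (\prod_(i < n) \prod_(j < n) q i j ^ (m i 0 * m' j 0))
    (monomial X m) (monomial X m').
Proof.
move=> q0 XU XX; apply: skew_commute_prod => i.
(* Exchange the two sides, so that the product to expand is again on the
   left, and exchange back once a single X j is isolated. *)
rewrite -[X in skew_commute X]invrK; apply: skew_commuteV.
  by rewrite invr_neq0 //; apply/prodf_neq0 => j _; apply: expfz_neq0.
rewrite -prodfV; apply: skew_commute_prod => j.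
apply: skew_commuteV; first exact: expfz_neq0.
rewrite mulrC -exprz_exp.
apply: skew_commuteXz => //; first exact: expfz_neq0.
rewrite -[q i j]invrK exprz_inv -invr_expz; apply: skew_commuteV.
  by rewrite expfz_neq0 // invr_neq0.
apply: skew_commuteXz; rewrite ?invr_neq0 //.
by apply: skew_commuteV.
Qed.

Lemma commutator_skew (F : fieldType) (A : unitAlgType F) (c : F) (u v : A) :
    u \is a GRing.unit -> v \is a GRing.unit ->
  skew_commute c u v -> commutator u v = c%:A.
Proof.
by move=> uU vU uv; rewrite /commutator uv -!scalerAl mulrK // divrr.
Qed.

Lemma monomial_unit (A : unitRingType) (n : nat) (X : 'I_n -> A)
    (m : 'cV[int]_n) :
  (forall i, X i \is a GRing.unit) -> monomial X m \is a GRing.unit.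
Proof. by move=> XU; apply: rpred_prod => i _; apply: unitrXz. Qed.

(** The identity of a unital algebra is nonzero here, so no scalar is lost in
    passing from the field to the algebra. *)
Lemma scalar_alg_inj (F : fieldType) (A : algType F) :
  injective (fun c : F => c%:A : A).
Proof.
move=> c d /eqP; rewrite -subr_eq0 -scalerBl scaler_eq0 oner_eq0 orbF subr_eq0.
by move/eqP.
Qed.

(** * The exponents of lambda in the free generators *)

Lemma big_ord4 (R : Type) (idx : R) (op : Monoid.law idx) (P : 'I_4 -> R) :
  \big[op/idx]_(i < 4) P i = op (op (op (P 0) (P 1)) (P 2)) (P 3).
Proof.
rewrite !big_ord_recl big_ord0 Monoid.mulm1 !Monoid.mulmA.
by congr (op (op (op (P _) (P _)) (P _)) (P _)); apply: val_inj.
Qed.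

Definition plucker (n : nat) (m m' : 'cV[int]_n) (i j : 'I_n) : int :=
  m i 0 * m' j 0 - m j 0 * m' i 0.

Definition lambda_coord (m m' : 'cV[int]_4) : {ffun 'I_4 -> int} :=
  [ffun p : 'I_4 =>
     nth 0 [:: plucker m m' 0 3; plucker m m' 1 2;
               plucker m m' 1 3; plucker m m' 2 3] p].

(** The factors q_ij and q_ji = q_ij^-1 of the bicharacter formula combine into
    q_ij raised to the Pluecker coordinate (i, j). *)
Lemma lambdaE (F : fieldType) (q : 'M[F]_4) (A : unitAlgType F)
    (X : 'I_4 -> A) (m m' : 'cV[int]_4) :
    mult_antisymmetric q ->
    (forall i, X i \is a GRing.unit) ->
    (forall i j, skew_commute (q i j) (X i) (X j)) ->
    q 0 1 = 1 -> q 0 2 = 1 ->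
  lambda X m m' =
    (\prod_(p < 4) nth 1 [:: q 0 3; q 1 2; q 1 3; q 2 3] p
                     ^ lambda_coord m m' p)%:A.
Proof.
move=> [q0 q1 qV] XU XX q01 q02; rewrite /lambda.
rewrite (commutator_skew _ _ (skew_commute_monomial m m' q0 XU XX));
  rewrite ?monomial_unit //.
congr (_ *: _).
rewrite !big_ord4 !ffunE /= /plucker !expfzDr // -!exprz_inv.
rewrite !q1 (qV 0 1) (qV 0 2) (qV 0 3) (qV 1 2) (qV 1 3) (qV 2 3) q01 q02.
rewrite invr1 !exp1rz; ring.
Qed.

(** * Integer matrices preserving Pluecker coordinates *)

Definition preserves_plucker (n : nat) (s : 'M[int]_n) (i j : 'I_n) :=
  forall m m' : 'cV[int]_n, plucker (s *m m) (s *m m') i j = plucker m m' i j.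

(** Evaluating on pairs of basis vectors turns the invariance into equations
    on the 2 x 2 minors of rows [i] and [j]. *)
Lemma preserves_plucker_minor (n : nat) (s : 'M[int]_n) (i j k l : 'I_n) :
    preserves_plucker s i j ->
  s i k * s j l - s j k * s i l
  = (i == k)%:R * (j == l)%:R - (j == k)%:R * (i == l)%:R.
Proof.
move=> /(_ (delta_mx k 0) (delta_mx l 0)).
by rewrite /plucker -!colE !mxE !andbT.
Qed.

(** With r_i and r_j the rows of [s]: if r_i /\ r_j = e_i^* /\ e_j^*, then they
    span the same plane as e_i^* and e_j^*, as
    r_i /\ e_i^* /\ e_j^* = r_i /\ r_i /\ r_j = 0, and likewise for r_j. *)
Lemma preserves_plucker_row (n : nat) (s : 'M[int]_n) (i j k : 'I_n) :
    i != j -> i != k -> j != k -> preserves_plucker s i j ->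
  s i k = 0 /\ s j k = 0.
Proof.
move=> ij ik jk sij.
have := preserves_plucker_minor i j sij.
have := preserves_plucker_minor i k sij.
have := preserves_plucker_minor j k sij.
rewrite !eqxx (eq_sym j i) (negPf ij) (negPf ik) (negPf jk) /=.
rewrite !mulr0n !mulr1n !mul0r !mulr0 !mulr1 !subr0 => jk0 ik0 ij1; split.
  (* Multiply s i k by the minor (i, j), which is 1, and expand: the result is
     a combination of the vanishing minors (i, k) and (j, k). *)
  transitivity (s i j * (s i i * s j k - s j i * s i k)
                - s i i * (s i j * s j k - s j j * s i k)).
    by rewrite -[LHS]mulr1 -ij1; ring.
  by rewrite jk0 ik0 !mulr0 subr0.
transitivity (s j j * (s i i * s j k - s j i * s i k)
              - s j i * (s i j * s j k - s j j * s i k)).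
  by rewrite -[LHS]mulr1 -ij1; ring.
by rewrite jk0 ik0 !mulr0 subr0.
Qed.

Lemma preserves_plucker_diag (n : nat) (s : 'M[int]_n) (i j : 'I_n) :
    i != j -> s i j = 0 -> preserves_plucker s i j ->
  s i i * s j j = 1.
Proof.
move=> ij sij0 /(preserves_plucker_minor i j).
rewrite sij0 !eqxx (eq_sym j i) (negPf ij) /= !mulr0n mulr1n.
by rewrite !mulr0 !subr0 mulr1.
Qed.

Definition signed_shear (b eps : int) : 'M[int]_4 :=
  mx_of_rows 4 4
    [:: [:: eps;   0;   0;  -b];
        [::   0; eps;   0;   0];
        [::   0;   0; eps;   0];
        [::   0;   0;   0; eps]].

Lemma ord4_ind (P : 'I_4 -> Prop) : P 0 -> P 1 -> P 2 -> P 3 -> forall i, P i.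
Proof.
move=> P0 P1 P2 P3 [[|[|[|[|//]]]] lti].
- by rewrite (_ : Ordinal lti = 0) //; apply: val_inj.
- by rewrite (_ : Ordinal lti = 1) //; apply: val_inj.
- by rewrite (_ : Ordinal lti = 2) //; apply: val_inj.
- by rewrite (_ : Ordinal lti = 3) //; apply: val_inj.
Qed.

(** Three of the pairs link the indices 1, 2, 3 in a triangle, which forces the
    last three rows onto the coordinate axes, while index 0 is only linked to 3:
    this is why the corner entry [s 0 3] alone remains free. *)
Lemma signed_shear_of_preserves_plucker (s : 'M[int]_4) :
    preserves_plucker s 0 3 -> preserves_plucker s 1 2 ->
    preserves_plucker s 1 3 -> preserves_plucker s 2 3 ->
  exists b eps : int, (eps = 1 \/ eps = -1) /\ s = signed_shear b eps.
Proof.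
move=> s03 s12 s13 s23.
have [s01 s31] := @preserves_plucker_row _ s 0 3 1 isT isT isT s03.
have [s02 s32] := @preserves_plucker_row _ s 0 3 2 isT isT isT s03.
have [s10 s20] := @preserves_plucker_row _ s 1 2 0 isT isT isT s12.
have [s13_0 s23_0] := @preserves_plucker_row _ s 1 2 3 isT isT isT s12.
have [_ s30] := @preserves_plucker_row _ s 1 3 0 isT isT isT s13.
have [s12_0 _] := @preserves_plucker_row _ s 1 3 2 isT isT isT s13.
have [s21 _] := @preserves_plucker_row _ s 2 3 1 isT isT isT s23.
have d12 := @preserves_plucker_diag _ s 1 2 isT s12_0 s12.
have d13 := @preserves_plucker_diag _ s 1 3 isT s13_0 s13.
have d23 := @preserves_plucker_diag _ s 2 3 isT s23_0 s23.
have d03 : s 0 0 * s 3 3 = 1.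
  by have := preserves_plucker_minor 0 3 s03; rewrite s30 mul0r subr0 => ->.
have cancel1 (x y z : int) : x * z = 1 -> y * z = 1 -> x = y.
  by move=> xz yz; rewrite -[LHS]mulr1 -yz mulrCA xz mulr1.
have e2 : s 2 2 = s 3 3.
  by apply: (@cancel1 _ _ (s 1 1)); rewrite mulrC.
have e1 : s 1 1 = s 3 3 by rewrite (cancel1 _ _ _ d13 d23).
have e0 : s 0 0 = s 3 3 by rewrite (cancel1 _ _ _ d03 d23).
have sq : s 3 3 * s 3 3 = 1 by rewrite -{1}e2.
exists (- s 0 3), (s 3 3); split.
  by move/eqP: sq; rewrite -expr2 sqrf_eq1 => /orP[]/eqP; [left|right].
by apply/matrixP; elim/ord4_ind; elim/ord4_ind;
  rewrite /signed_shear mxE /= ?opprK.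
Qed.

Lemma signed_shear_mulcV (b eps : int) (m : 'cV[int]_4) :
  [/\ (signed_shear b eps *m m) 0 0 = eps * m 0 0 - b * m 3 0,
      (signed_shear b eps *m m) 1 0 = eps * m 1 0,
      (signed_shear b eps *m m) 2 0 = eps * m 2 0
    & (signed_shear b eps *m m) 3 0 = eps * m 3 0].
Proof.
split; rewrite mxE big_ord4 !mxE /=; ring.
Qed.

Lemma signed_shear_unit (b eps : int) :
  eps = 1 \/ eps = -1 -> signed_shear b eps \in unitmx.
Proof.
(* The inverse keeps the sign and negates b. *)
move=> eps1; apply: (proj1 (@mulmx1_unit _ _ _ (signed_shear (- b) eps) _)).
apply/matrixP; elim/ord4_ind; elim/ord4_ind; rewrite !mxE big_ord4 !mxE /=;
  case: eps1 => ->; ring.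
Qed.

(** * The automorphism group *)

(** Freeness of the generators lets exponents be compared one by one; this
    turns the multiplicative condition on lambda into four additive ones. *)
Lemma in_AutE (F : fieldType) (q : 'M[F]_4) (A : unitAlgType F)
    (X : 'I_4 -> A) (s : 'M[int]_4) :
    mult_antisymmetric q ->
    (forall i, X i \is a GRing.unit) ->
    (forall i j, skew_commute (q i j) (X i) (X j)) ->
    injective (fun k : {ffun 'I_4 -> int} =>
      \prod_(p < 4) nth 1 [:: q 0 3; q 1 2; q 1 3; q 2 3] p ^ k p) ->
    q 0 1 = 1 -> q 0 2 = 1 ->
  in_Aut X s <->
  s \in unitmx /\ [/\ preserves_plucker s 0 3, preserves_plucker s 1 2,
                     preserves_plucker s 1 3 & preserves_plucker s 2 3].
Proof.
move=> hq XU XX free q01 q02.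
split=> -[sU sP]; split=> //; last first.
  move=> m m'; rewrite !(lambdaE _ _ hq XU XX q01 q02).
  case: sP => s03 s12 s13 s23.
  suff -> : lambda_coord (s *m m) (s *m m') = lambda_coord m m' by [].
  by apply/ffunP => p; rewrite !ffunE s03 s12 s13 s23.
have sL m m' : lambda_coord (s *m m) (s *m m') = lambda_coord m m'.
  apply/free/(@scalar_alg_inj F A).
  by have := sP m m'; rewrite !(lambdaE _ _ hq XU XX q01 q02).
by split=> m m'; have /ffunP sLm := sL m m';
  [have := sLm 0 | have := sLm 1 | have := sLm 2 | have := sLm 3];
  rewrite !ffunE.
Qed.

Theorem proposition2p2 (F : fieldType) (q : 'M[F]_4)
    (hq : mult_antisymmetric q)
    (A : unitAlgType F) (X : 'I_4 -> A)
    (hA : is_quantum_torus q X)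
    (hfree : freely_generated_by (in_Lambda q)
               (fun i : 'I_4 => nth 1 [:: q 0 3; q 1 2; q 1 3; q 2 3] i))
    (h12 : q 0 1 = 1) (h13 : q 0 2 = 1) (s : 'M[int]_4) :
  in_Aut X s <->
  exists b eps : int, (eps = 1 \/ eps = -1) /\
    s = mx_of_rows 4 4
          [:: [:: eps;   0;   0;  -b];
              [::   0; eps;   0;   0];
              [::   0;   0; eps;   0];
              [::   0;   0;   0; eps]].
Proof.
case: hA => XU XX _; case: hfree => _ free.
rewrite (in_AutE s hq XU XX free h12 h13); split.
  by case=> _ [s03 s12 s13 s23]; apply: signed_shear_of_preserves_plucker.
case=> b [eps [eps1 ->]]; rewrite -/(signed_shear b eps).
split; first exact: signed_shear_unit.
by split=> m m'; have [m0 m1 m2 m3] := signed_shear_mulcV b eps m;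
  have [m'0 m'1 m'2 m'3] := signed_shear_mulcV b eps m';
  rewrite /plucker ?m0 ?m1 ?m2 ?m3 ?m'0 ?m'1 ?m'2 ?m'3; case: eps1 => ->; ring.
Qed.
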